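(* Let $X_1,\dots,X_n$ be independent real-valued random variables with $E|X_k|^{3+\delta}<\infty$ for $1\le k\le n$ and for some $\delta\in(0,1]$. Put $\mu_k:=E[X_k]$, $v_k^2:=\mathrm{Var}(X_k)$, $S_n:=\sum_{k=1}^n(X_k-\mu_k)$ and $\sigma_n^2:=\sum_{k=1}^nv_k^2$, and assume $\sigma_n>0$. Suppose that $\sum_{k=1}^nE[(X_k-\mu_k)^3]=0$. Then $$d_2(S_n/\sigma_n,N)\leq\frac{C_\delta}{\sigma_n^{3+\delta}}\sum_{k=1}^nE|X_k-\mu_k|^{3+\delta},$$ where $C_\delta:=8+2^{2+\delta}\Big(3^{\frac{\delta}{3}}\big(2+3^{\frac{3+\delta}{3}}\big)\Big)^{\frac{3}{3+\delta}}+2^{4+\delta}$.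
   Context: $N$ is a standard normal random variable, and $E|Y|^p$ means $E[|Y|^p]$. The $d_2$-distance is $d_2(G,N):=\sup\{|E[h(G)]-E[h(N)]| : h\in\mathcal{C}^2,\ \|h'\|_\infty\le 1,\ \|h''\|_\infty\le 1\}$, where $\mathcal{C}^2$ is the space of twice continuously differentiable $h:\mathbb{R}\to\mathbb{R}$ and $\|\cdot\|_\infty$ is the supremum norm. *)

(* Defs.v *)
From HB Require Import structures.
From mathcomp Require Import all_boot all_order all_algebra.
From mathcomp Require Import all_classical all_reals all_analysis.

Set Implicit Arguments.
Unset Strict Implicit.
Unset Printing Implicit Defensive.

Import Order.TTheory GRing.Theory Num.Def Num.Theory.
Import numFieldNormedType.Exports.

Local Open Scope ring_scope.
Local Open Scope classical_set_scope.

Definition mutually_independent (d : measure_display) (T : measurableType d)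
    (R : realType) (P : probability T R) (n : nat)
    (X : 'I_n -> {RV P >-> R}) : Prop :=
  forall (J : {set 'I_n}) (B : 'I_n -> set R),
    (forall i, i \in J -> measurable (B i)) ->
    P (\bigcap_(i in [set` J]) (X i @^-1` B i)) =
    (\prod_(i in J) P (X i @^-1` B i))%E.

(* The law is compared on measurable sets only: on other sets [normal_prob]
   takes unspecified values. *)
Definition standard_normal (d : measure_display) (T : measurableType d)
    (R : realType) (P : probability T R) (N : {RV P >-> R}) : Prop :=
  forall B : set R, measurable B -> distribution P N B = normal_prob 0 1 B.

Definition sup_norm (R : realType) (f : R -> R) : \bar R :=
  ereal_sup (range (fun x => `|f x|%:E)).

Definition C2 (R : realType) (h : R -> R) : Prop :=
  [/\ forall x, derivable h x 1,
      forall x, derivable h^`() x 1 &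
      continuous h^`(2)].

Definition d2_class (R : realType) : set (R -> R) :=
  [set h | [/\ C2 h, (sup_norm h^`() <= 1)%E & (sup_norm h^`(2) <= 1)%E]].

(* The two variables may live on different probability spaces; the test
   functions are Lipschitz, so for integrable [G] and [N] both expectations
   are finite. *)
Definition d2 (d d' : measure_display) (T : measurableType d)
    (T' : measurableType d') (R : realType)
    (P : probability T R) (G : T -> R) (Q : probability T' R) (N : T' -> R) :
    \bar R :=
  ereal_sup [set `|'E_P[h \o G] - 'E_Q[h \o N]|%E | h in @d2_class R].

Definition mean (d : measure_display) (T : measurableType d) (R : realType)
    (P : probability T R) (X : T -> R) : R := fine 'E_P[X]%E.

Definition centered (d : measure_display) (T : measurableType d)
    (R : realType) (P : probability T R) (X : T -> R) : T -> R :=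
  fun w => X w - mean P X.

Definition centered_sum (d : measure_display) (T : measurableType d)
    (R : realType) (P : probability T R) (n : nat)
    (X : 'I_n -> {RV P >-> R}) : T -> R :=
  fun w => \sum_(k < n) centered P (X k) w.

Definition sigma (d : measure_display) (T : measurableType d)
    (R : realType) (P : probability T R) (n : nat)
    (X : 'I_n -> {RV P >-> R}) : R :=
  Num.sqrt (\sum_(k < n) fine 'V_P[X k]%E).

Definition C_ (R : realType) (delta : R) : R :=
  8 + 2 `^ (2 + delta) *
      (3 `^ (delta / 3) * (2 + 3 `^ ((3 + delta) / 3))) `^ (3 / (3 + delta))
    + 2 `^ (4 + delta).

(* Main.v *)
Require Import Defs.
From HB Require Import structures.
From mathcomp Require Import all_boot all_order all_algebra.
From mathcomp Require Import all_classical all_reals all_analysis.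
From mathcomp Require Import measurable_realfun.
From mathcomp Require Import ring lra.

Set Implicit Arguments.
Unset Strict Implicit.
Unset Printing Implicit Defensive.

Import Order.TTheory GRing.Theory Num.Def Num.Theory.
Import numFieldNormedType.Exports.

Local Open Scope classical_set_scope.
Local Open Scope ring_scope.

(** The proof is Stein's method. Let h be a test function of the class
    defining the distance and c its Gaussian mean. The equation
    f' - x f = h - c has a solution f with |f| <= 1, |f'| <= 1/2,
    |f''| <= 5/2 and f'' 4-Lipschitz ([stein_equation]), so that f'' is
    Hoelder of every exponent delta in (0, 1] with constant 5. Write
    Z_k = (X_k - mu_k) / sigma and W for the sum of the Z_k; then
    E[h(W)] - c = E[f'(W) - W f(W)] = E[f'(W)] - sum_k E[Z_k f(W)].

    Each E[Z_k f(W)] is expanded around W - Z_k, which is independent of Z_k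
    ([leave_one_out_expansion]): up to 5/2 * 5 * E|Z_k|^(3 + delta) it equals
    E[Z_k^2] E[f'(W)] + E[Z_k^3] / 2 * E[f''(W)]. The two expectations
    E[f'(W)] and E[f''(W)] do not depend on k. Summing over k, the second
    moments add up to 1 and cancel E[f'(W)], the third moments add up to 0,
    and only the errors are left ([stein_discrepancy_le]). The argument thus
    yields the constant 25/2, which is at most C_delta.

    The bounds on f follow from differentiating the Stein equation rather than
    from its explicit solution: f'' - x f' - f = h' and
    (f')'' - x (f')' - 2 f' = h'' are Ornstein-Uhlenbeck equations, for which a
    maximum principle on the whole line gives |f| <= 1 and |f'| <= 1/2
    ([ornstein_uhlenbeck_max]); and g = f'' solves g' - x g = 2 f' + h'', which
    forces |x g| <= 2 ([drift_bound]), hence the Lipschitz bound on f''. The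
    explicit solution only serves to know a priori that f is bounded at infinity. *)

(** * Calculus and maximum principles *)

Section calculus.
Variable R : realType.
Implicit Types f g u : R -> R.

Lemma is_derive_addf f g df dg (x : R) : is_derive x 1 f df ->
  is_derive x 1 g dg -> is_derive x 1 (fun y => f y + g y) (df + dg).
Proof. by move=> hf hg; exact: is_deriveD. Qed.

Lemma is_derive_subf f g df dg (x : R) : is_derive x 1 f df ->
  is_derive x 1 g dg -> is_derive x 1 (fun y => f y - g y) (df - dg).
Proof. by move=> hf hg; exact: is_deriveB. Qed.

Lemma is_derive_oppf f df (x : R) : is_derive x 1 f df ->
  is_derive x 1 (fun y => - f y) (- df).
Proof. by move=> hf; exact: is_deriveN. Qed.

Lemma is_derive_mulf f g df dg (x : R) : is_derive x 1 f df ->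
  is_derive x 1 g dg ->
  is_derive x 1 (fun y => f y * g y) (df * g x + f x * dg).
Proof.
move=> hf hg; apply: (@is_derive_eq _ _ _ _ _ _ _ _ (is_deriveM hf hg)).
by rewrite /GRing.scale/= addrC [g x * _]mulrC.
Qed.

Lemma is_derive_compf f g df dg (x : R) : is_derive (g x) 1 f df ->
  is_derive x 1 g dg -> is_derive x 1 (fun y => f (g y)) (df * dg).
Proof. by move=> hf hg; exact: is_derive1_comp. Qed.

Lemma is_derive_reflect f df (x : R) : is_derive (- x) 1 f df ->
  is_derive x 1 (fun y => f (- y)) (- df).
Proof.
move=> hf; rewrite -mulrN1.
by apply: is_derive_compf; apply: is_deriveNid.
Qed.

Lemma is_derive_continuous f f' : (forall x : R, is_derive x 1 f (f' x)) ->
  continuous f.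
Proof.
move=> h x; have [+ _] := h x.
by move=> /derivable1_diffP; exact: differentiable_continuous.
Qed.

Lemma is_derive_le_ge0 f f' (a b : R) : a <= b ->
  (forall x : R, a <= x -> is_derive x 1 f (f' x)) ->
  (forall x, a <= x -> 0 <= f' x) -> f a <= f b.
Proof.
move=> ab df f0; rewrite le_eqVlt in ab; case/predU1P: ab => [->//|ab].
have [||c] := @MVT _ f f' a b ab.
- by move=> x; rewrite in_itv/= => /andP[/ltW /df].
- apply: derivable_within_continuous => x; rewrite in_itv/= => /andP[/df[]].
  by [].
rewrite in_itv/= => /andP[/ltW /f0 hc _] h.
by rewrite -subr_ge0 h mulr_ge0// subr_ge0 ltW.
Qed.

(** Comparison principle for first-order equations: the difference of a
    subsolution and a supersolution is monotone up to an integrating factor,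
    and its sign is read off at infinity. *)
Lemma le_of_derive_ge0_cvg0 u u' (a : R) :
  (forall x : R, a <= x -> is_derive x 1 u (u' x)) ->
  (forall x, a <= x -> 0 <= u' x) -> u x @[x --> +oo] --> 0 -> u a <= 0.
Proof.
move=> du u0 cu; apply: (cvgr_to_ge cu).
near=> x; apply: (is_derive_le_ge0 _ du u0).
by near: x; apply: nbhs_pinfty_ge; exact: num_real.
Unshelve. all: by end_near. Qed.

Lemma mean_value f f' (a b : R) : (forall x : R, is_derive x 1 f (f' x)) ->
  exists2 c, `|c - a| <= `|b - a| & f b - f a = f' c * (b - a).
Proof.
move=> df; have cf : continuous f := is_derive_continuous df.
have [ab|ba] := leP a b.
  have [c] := MVT_segment ab (fun x _ => df x) (continuous_subspaceT cf).
  rewrite in_itv/= => /andP[ac cb] e; exists c => //.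
  by rewrite !ger0_norm ?subr_ge0// lerD2r.
have [c] := MVT_segment (ltW ba) (fun x _ => df x) (continuous_subspaceT cf).
rewrite in_itv/= => /andP[ac cb] e; exists c => //.
  by rewrite !ler0_norm ?subr_le0 ?(ltW ba)// lerN2 lerD2r.
by rewrite -opprB e -mulrN opprB.
Qed.

(** Were f2 positive, f1 would be positive just to the right of c, and the mean
    value theorem would produce values of f above the maximum. *)
Lemma second_derivative_at_max (f f1 : R -> R) (f2 a b c : R) :
  (forall x : R, is_derive x 1 f (f1 x)) -> is_derive c 1 f1 f2 ->
  a < c < b -> (forall x, a <= x <= b -> f x <= f c) -> f1 c = 0 /\ f2 <= 0.
Proof.
move=> df [df1 ddf1] /andP[ac cb] fmax.
have f1c : f1 c = 0.
  have : is_derive c 1 f 0.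
    apply: (@derive1_at_max _ f a b c).
    - exact: ltW (lt_trans ac cb).
    - by move=> t _; case: (df t).
    - by rewrite in_itv/= ac.
    - by move=> t; rewrite in_itv/= => /andP[/ltW at' /ltW tb]; apply: fmax; rewrite at'.
  by case=> _ <-; case: (df c).
split => //; rewrite leNgt; apply/negP => f20.
have : h^-1 *: ((f1 \o shift c) (h *: 1) - f1 c) @[h --> 0^'] --> f2.
  by rewrite -ddf1; exact: df1.
move/(cvgr_gt f2)/(_ _ f20) => /=.
rewrite near_withinE near_simpl => /nbhs_ballP[e /= e0 He].
pose x := c + Num.min (e / 2) (b - c).
have m0 : 0 < Num.min (e / 2) (b - c) by rewrite lt_min divr_gt0//= subr_gt0.
have cx : c < x by rewrite ltrDl.
have [y] := MVT cx (fun z _ => df z)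
  (continuous_subspaceT (is_derive_continuous df)).
rewrite in_itv/= => /andP[cy yx] fE.
have yc0 : 0 < y - c by rewrite subr_gt0.
have := He (y - c); rewrite /ball/= sub0r normrN gtr0_norm//.
have -> : y - c < e.
  rewrite ltrBlDl (lt_le_trans yx)// lerD2l ge_min; apply/orP; left.
  by rewrite ler_pdivrMr// ler_peMr ?ltW// ltr1n.
move=> /(_ isT); rewrite gt_eqF// => /(_ isT).
rewrite /= /GRing.scale/= mulr1 subrK f1c subr0 pmulr_rgt0 ?invr_gt0// => f1y.
have : f x <= f c.
  apply: fmax; rewrite (ltW (lt_trans ac cx))/= /x -lerBrDl ge_min.
  by rewrite lexx orbT.
by rewrite -subr_le0 fE leNgt mulr_gt0// subr_gt0.
Qed.

(** Maximum principle for the operator g'' - x g' - a g on the whole line. The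
    penalized function g - e x^2 attains its maximum because g grows at most
    linearly; there g' = 2 e x, so the drift term - x g' = - 2 e x^2 has the
    favourable sign, and letting e tend to 0 removes the penalty. *)
Lemma ornstein_uhlenbeck_max_le (g g1 g2 : R -> R) (a K D : R) :
  (forall x : R, is_derive x 1 g (g1 x)) -> (forall x : R, is_derive x 1 g1 (g2 x)) ->
  0 < a -> 0 <= K -> 0 <= D -> (forall x, 1 <= `|x| -> g x <= D * `|x|) ->
  (forall x, a * g x <= K + (g2 x - x * g1 x)) ->
  forall x, g x <= K / a.
Proof.
move=> dg dg1 a0 K0 D0 gD gE x0.
apply/ler_addgt0Pr => e' e'0.
(* The penalization costs 2 e / a at the maximum point and e x0^2 at x0; this e
   makes the total at most e'. *)
pose e := e' / (2 / a + x0 ^+ 2 + 1).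
have den0 : 0 < 2 / a + x0 ^+ 2 + 1.
  by rewrite ltr_wpDl// addr_ge0 ?sqr_ge0// divr_ge0// ltW.
have e0 : 0 < e by rewrite divr_gt0.
pose u x := g x - e * x ^+ 2.
have du (x : R) : is_derive x 1 u (g1 x - e * (2 * x)).
  apply: (is_derive_subf (dg x)).
  apply: is_derive_eq; rewrite /GRing.scale/=; ring.
have du1 (x : R) : is_derive x 1 (fun x => g1 x - e * (2 * x)) (g2 x - e * 2).
  apply: (is_derive_subf (dg1 x)).
  apply: is_derive_eq; rewrite /GRing.scale/=; ring.
pose b := Num.max (`|x0| + 1) (D / e).
have b1 : `|x0| + 1 <= b by rewrite le_max lexx.
have b0 : 0 < b by rewrite (lt_le_trans _ b1)// ltr_wpDl.
have De : D <= b * e by rewrite -ler_pdivrMr// le_max lexx orbT.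
have Nbb : - b <= b by rewrite ltW// gtrN.
have [c cb cmax] := EVT_max Nbb
  (continuous_subspaceT (is_derive_continuous du)).
have x0b : x0 \in `[- b, b] by rewrite in_itv/= -ler_norml (le_trans _ b1)// lerDl.
have ux0 := cmax _ x0b.
have gx0 : g x0 <= u c + e * x0 ^+ 2 by rewrite -lerBlDr.
have e'E : 2 * e / a + e * x0 ^+ 2 <= e'.
  rewrite [leRHS](_ : _ = e * (2 / a + x0 ^+ 2 + 1)); last first.
    by rewrite /e divfK// gt_eqF.
  have -> : e * (2 / a + x0 ^+ 2 + 1) = 2 * e / a + e * x0 ^+ 2 + e by ring.
  by rewrite lerDl ltW.
suff uc : u c <= (K + 2 * e) / a.
  rewrite (le_trans gx0)//; apply: (le_trans (lerD uc (lexx _))).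
  by rewrite mulrDl -addrA lerD2l.
(* On the boundary of the interval the penalty has already won over the linear
   growth of g. *)
have [cbE|cbN] := eqVneq `|c| b.
  apply: (@le_trans _ _ 0); last first.
    apply: divr_ge0; last exact: ltW.
    by apply: addr_ge0 => //; apply: mulr_ge0 => //; exact: ltW.
  rewrite subr_le0 (le_trans (gD c _))//; first by rewrite cbE (le_trans _ b1)// lerDr.
  rewrite -real_normK ?num_real// cbE (@le_trans _ _ (b * e * b))//.
    by rewrite ler_pM2r.
  by rewrite expr2 mulrAC mulrC.
have /andP[cb1 cb2] : - b < c < b.
  rewrite -ltr_norml lt_neqAle cbN/= ler_norml.
  by move: cb; rewrite in_itv.
have [||u1c u2c] := @second_derivative_at_max u (fun x => g1 x - e * (2 * x)) (g2 c - e * 2) (- b) b c du (du1 c).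
- by rewrite cb1.
- by move=> y yb; apply: cmax; rewrite in_itv.
rewrite ler_pdivlMr// mulrC.
have g1c : g1 c = e * (2 * c) by apply/eqP; rewrite -subr_eq0 u1c.
rewrite /u mulrBr.
have := gE c; rewrite g1c.
have ec0 : 0 <= e * c ^+ 2 := mulr_ge0 (ltW e0) (sqr_ge0 c).
have := mulr_ge0 (ltW a0) ec0; move: ec0.
move: u2c; set Z := e * c^+2; rewrite (_ : c * (e * (2 * c)) = 2 * Z); last by rewrite /Z; ring.
lra.
Qed.

Lemma ornstein_uhlenbeck_max (g g1 g2 k : R -> R) (a K D : R) :
  (forall x : R, is_derive x 1 g (g1 x)) -> (forall x : R, is_derive x 1 g1 (g2 x)) ->
  0 < a -> (forall x, 1 <= `|x| -> `|g x| <= D * `|x|) ->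
  (forall x, `|k x| <= K) -> (forall x, g2 x - x * g1 x - a * g x = k x) ->
  forall x, `|g x| <= K / a.
Proof.
move=> dg dg1 a0 gD kK gE x.
have K0 : 0 <= K by exact: le_trans (kK 0).
have D0 : 0 <= D.
  by have := gD 1; rewrite normr1 mulr1 => h; exact: le_trans (h _).
rewrite ler_norml; apply/andP; split.
  rewrite lerNl; apply: (@ornstein_uhlenbeck_max_le (fun x => - g x) (fun x => - g1 x)
    (fun x => - g2 x) a K D) => // y.
  - by move=> /gD; rewrite ler_norml => /andP[+ _]; rewrite lerNl.
  - have := kK y; rewrite -gE ler_norml; lra.
apply: (@ornstein_uhlenbeck_max_le g g1 g2 a K D) => // y.
- by move=> /gD; exact/le_trans/ler_norm.
- have := kK y; rewrite -gE ler_norml; lra.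
Qed.

End calculus.

(** * Gaussian integrals and tails *)

Section gaussian.
Variable R : realType.
Notation mu := (@lebesgue_measure R).
Notation phi := (@normal_pdf R 0 1).

Lemma centered_normal_pdfE (s x : R) : s != 0 ->
  normal_pdf 0 s x = normal_peak s * expR (- (x ^+ 2 / (s ^+ 2 *+ 2))).
Proof.
by move=> s0; rewrite /normal_pdf (negbTE s0) /normal_fun subr0 mulNr.
Qed.

Lemma centered_normal_pdf_gt0 (s x : R) : s != 0 -> 0 < normal_pdf 0 s x.
Proof.
by move=> s0; rewrite centered_normal_pdfE// mulr_gt0 ?expR_gt0// normal_peak_gt0.
Qed.

Lemma is_derive_normal_pdf (x : R) : is_derive x 1 phi (- x * phi x).
Proof.
have -> : phi = fun y => normal_peak 1 * expR (- (2^-1 * y ^+ 2)).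
  apply/funext => y; rewrite centered_normal_pdfE ?oner_eq0//.
  by rewrite expr1n [y ^+ 2 / _]mulrC.
apply: is_derive_eq.
by rewrite /GRing.scale/=; field.
Qed.

Lemma cvg_normal_pdfy (s : R) : s != 0 -> normal_pdf 0 s x @[x --> +oo] --> 0.
Proof.
move=> s0.
have s20 : 0 < s ^+ 2 *+ 2 by rewrite pmulrn_lgt0// exprn_even_gt0.
apply: (@squeeze_cvgr _ _ _ _ (cst 0) (fun x => normal_peak s * expR (- x))).
- near=> x; rewrite normal_pdf_ge0/= centered_normal_pdfE//.
  rewrite ler_wpM2l ?normal_peak_ge0// ler_expR lerN2 ler_pdivlMr// expr2.
  by rewrite ler_wpM2l//; near: x; apply: nbhs_pinfty_ge; exact: num_real.
- exact: cvg_cst.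
- by rewrite -[X in _ --> X](mulr0 (normal_peak s)); apply: cvgMl_tmp; exact: cvgr_expR.
Unshelve. all: by end_near. Qed.

(** The density of variance 4 is an integrable majorant for all functions of
    linear growth times the standard density. *)
Lemma normal_pdf_domination : exists2 C : R, 0 <= C &
  forall x, (1 + `|x|) * phi x <= C * normal_pdf 0 2 x.
Proof.
have p2 : 0 < normal_peak (2 : R) by rewrite normal_peak_gt0.
exists (2 * normal_peak 1 / normal_peak 2).
  by rewrite divr_ge0 ?mulr_ge0 ?normal_peak_ge0.
move=> x; rewrite !centered_normal_pdfE ?oner_eq0//.
rewrite mulrCA [leRHS](_ : _ = normal_peak 1 * (2 * expR (- (x ^+ 2 / (2 ^+ 2 *+ 2))))); last first.
  by field; rewrite gt_eqF.
rewrite ler_wpM2l ?normal_peak_ge0//.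
have -> : - (x ^+ 2 / (1 ^+ 2 *+ 2)) = - (x ^+ 2 / (2 ^+ 2 *+ 2)) - 3 / 8 * x ^+ 2.
  by field.
rewrite expRD mulrCA [2 * _]mulrC ler_wpM2l ?expR_ge0// expRN.
rewrite ler_pdivrMr ?expR_gt0//.
apply: (@le_trans _ _ (2 * (1 + 3 / 8 * x ^+ 2))); last first.
  by rewrite ler_wpM2l// expR_ge1Dx.
rewrite -(real_normK (num_real x)); set y := `|x|.
have := sqr_ge0 (y - 2 / 3); nra.
Qed.

(** On a half-line of nonnegative numbers, D * phi has derivative
    - D * x * phi, so u - D * phi is nondecreasing, u + D * phi is nonincreasing
    and both tend to 0. *)
Lemma gaussian_tail_le (u r : R -> R) (a D : R) : 0 <= a ->
  (forall x : R, a <= x -> is_derive x 1 u (r x)) ->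
  (forall x, a <= x -> `|r x| <= D * (x * phi x)) ->
  u x @[x --> +oo] --> 0 -> `|u a| <= D * phi a.
Proof.
move=> a0 du rD u0.
have Dphi0 : D * phi x @[x --> +oo] --> 0.
  rewrite -[X in _ --> X](mulr0 D); apply: cvgMl_tmp.
  by apply: cvg_normal_pdfy; rewrite oner_eq0.
have dDphi (x : R) : is_derive x 1 (fun y => D * phi y) (D * (- x * phi x)).
  have := is_derive_mulf (is_derive_cst D x 1) (is_derive_normal_pdf x).
  by rewrite mul0r add0r.
rewrite ler_norml; apply/andP; split.
  rewrite lerNl -subr_le0.
  apply: (@le_of_derive_ge0_cvg0 _ (fun y => - u y - D * phi y) (fun y => - r y - D * (- y * phi y))).
  - by move=> x ax; apply: is_derive_subf => //; apply: is_derive_oppf; exact: du.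
  - move=> x /rD; rewrite ler_norml => /andP[_ h].
    by rewrite mulNr mulrN opprK addrC subr_ge0.
  - by rewrite -[X in _ --> X](subrr 0); apply: cvgB => //; rewrite -oppr0; exact: cvgN.
rewrite -subr_le0.
apply: (@le_of_derive_ge0_cvg0 _ (fun y => u y - D * phi y) (fun y => r y - D * (- y * phi y))).
- by move=> x ax; apply: is_derive_subf => //; exact: du.
- move=> x /rD; rewrite ler_norml => /andP[h _].
  by rewrite mulNr mulrN opprK addrC -lerBlDl sub0r.
- by rewrite -[X in _ --> X](subrr 0); apply: cvgB.
Qed.

(** The Radon-Nikodym derivative of the normal law is its density, almost
    everywhere. *)
Lemma integral_normal_prob (f : R -> \bar R) :
  (normal_prob 0 1).-integrable setT f ->
  (\int[normal_prob 0 1]_x f x = \int[mu]_x (f x * (phi x)%:E))%E.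
Proof.
move=> fi; have mf := measurable_int _ fi.
have dom := @normal_prob_dominates R 0 1.
rewrite -(Radon_Nikodym_change_of_variables dom)//=.
apply: ae_eq_integral => //.
- by apply: emeasurable_funM => //; apply: (measurable_int mu); exact: Radon_Nikodym_integrable.
- apply: emeasurable_funM => //; apply/measurable_EFinP; exact: measurable_normal_pdf.
- apply: ae_eqe_mul2l => /=.
  apply: integral_ae_eq => //=.
  + exact: Radon_Nikodym_integrable.
  + by apply/measurable_EFinP; exact: measurable_normal_pdf.
  + by move=> E _ mE; rewrite -Radon_Nikodym_integral.
Qed.

(** Version for nonnegative functions, from which integrability against the
    normal law is deduced. *)
Lemma ge0_integral_normal_prob (f : R -> \bar R) :
  measurable_fun setT f -> (forall x, 0 <= f x)%E ->
  (\int[normal_prob 0 1]_x f x = \int[mu]_x (f x * (phi x)%:E))%E.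
Proof.
move=> mf f0.
have dom := @normal_prob_dominates R 0 1.
rewrite -(Radon_Nikodym_SigmaFinite.change_of_variables dom)//=.
apply: ae_eq_integral => //.
- apply: emeasurable_funM => //; apply: (measurable_int mu).
  exact: Radon_Nikodym_SigmaFinite.f_integrable.
- apply: emeasurable_funM => //; apply/measurable_EFinP; exact: measurable_normal_pdf.
- apply: ae_eqe_mul2l => /=.
  apply: integral_ae_eq => //=.
  + exact: Radon_Nikodym_SigmaFinite.f_integrable.
  + by apply/measurable_EFinP; exact: measurable_normal_pdf.
  + by move=> E _ mE; rewrite -Radon_Nikodym_SigmaFinite.f_integral.
Qed.

Lemma linear_growth (h h1 : R -> R) :
  (forall x : R, is_derive x 1 h (h1 x)) -> (forall x, `|h1 x| <= 1) ->
  forall x, `|h x| <= `|h 0| + `|x|.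
Proof.
move=> dh h1b x; have [c _] := mean_value 0 x dh; rewrite subr0 => e.
rewrite -[h x](subrK (h 0)) e addrC (le_trans (ler_normD _ _))// lerD2l.
by rewrite normrM ler_piMl.
Qed.

Lemma integrable_normal_prob (f : R -> R) (A : R) : measurable_fun setT f ->
  (forall x, `|f x| <= A * (1 + `|x|)) ->
  (normal_prob 0 1).-integrable setT (EFin \o f).
Proof.
move=> mf fA; apply/integrableP; split; first exact/measurable_EFinP.
have [C C0 HC] := normal_pdf_domination.
have A0 : 0 <= A.
  by have := fA 0; rewrite normr0 addr0 mulr1; exact: le_trans.
rewrite ge0_integral_normal_prob//; last first.
  by apply/measurable_EFinP; exact: measurableT_comp.
apply: (@le_lt_trans _ _ (\int[mu]_x ((A * C) * normal_pdf 0 2 x)%:E)%E).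
  apply: ge0_le_integral => //.
  - by move=> x _; rewrite mule_ge0// lee_fin normal_pdf_ge0.
  - apply: emeasurable_funM; apply/measurable_EFinP.
      exact: measurableT_comp.
    exact: measurable_normal_pdf.
  - apply/measurable_EFinP; apply: measurable_funM => //.
    exact: measurable_normal_pdf.
  - move=> x _; rewrite -EFinM lee_fin -mulrA.
    apply: (le_trans (ler_wpM2r (normal_pdf_ge0 _ _ _) (fA x))).
    by rewrite -mulrA ler_wpM2l.
under eq_integral do rewrite EFinM.
rewrite integralZl//; last exact: integrable_normal_pdf.
by rewrite integral_normal_pdf mule1 ltry.
Qed.

(** These are the tails of the distribution function of the identity, as a
    random variable on the line endowed with its normal law. *)
Lemma cvg_integral_normal_pdf (s : R) :
  fine (normal_prob 0 s `]x, +oo[) @[x --> +oo] --> 0 /\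
  fine (normal_prob 0 s `]-oo, (- x)]) @[x --> +oo] --> 0.
Proof.
have mid : @isMeasurableFun _ _ (measurableTypeR R) R idfun.
  by constructor; exact: measurable_id.
pose X : {RV (normal_prob 0 s) >-> R} := HB.pack (idfun : measurableTypeR R -> R) mid.
split.
  by have /fine_cvg := cvg_ccdfy0 X.
by have /cvgNy_compNP/fine_cvg := cvg_cdfNy0 X.
Qed.

(** The primitive F is the integral of rho from - oo. It vanishes at + oo
    because the total mass of rho is 0: this is where the centering of the test
    function at its Gaussian mean enters. *)
Lemma primitive_vanishing (rho : R -> R) (C : R) : continuous rho ->
  (forall x, `|rho x| <= C * normal_pdf 0 2 x) ->
  (\int[mu]_x (rho x)%:E = 0)%E ->
  exists F : R -> R, [/\ forall x : R, is_derive x 1 F (rho x),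
    F x @[x --> +oo] --> 0 & F (- x) @[x --> +oo] --> 0].
Proof.
move=> crho rhoC int0.
have mrho : measurable_fun setT rho by exact: continuous_measurable_fun.
have irho : mu.-integrable setT (EFin \o rho).
  apply: (le_integrable _ _ _ (integrableZl _ C (@integrable_normal_pdf R 0 2))) => //.
    exact/measurable_EFinP.
  by move=> x _; rewrite /= lee_fin (le_trans (rhoC x))// ler_norm.
have bound (A : set R) : measurable A ->
    `|\int[mu]_(t in A) rho t| <= C * fine (normal_prob 0 2 A).
  move=> mA.
  have iA : mu.-integrable A (EFin \o rho) by exact: integrableS irho.
  have pA : mu.-integrable A (EFin \o normal_pdf 0 2).
    by apply: integrableS (@integrable_normal_pdf R 0 2).
  apply: (le_trans (le_normr_Rintegral (mu := mu) mA iA)).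
  rewrite /normal_prob -RintegralZl//; apply: le_Rintegral => //.
  - exact: integrable_norm.
  - exact: (integrableZl (mu := mu) mA C pA).
pose F x := \int[mu]_(t in `]-oo, x]) rho t.
exists F; split.
- move=> x.
  have ix : mu.-integrable [set` Interval -oo%O (BRight (x + 1))] (EFin \o rho).
    exact: integrableS irho.
  have xx1 : x < x + 1 by rewrite ltrDl.
  have [+ +] := continuous_FTC1 xx1 ix (ltNyr _) (crho x).
  by rewrite derive1E; exact: DeriveDef.
- apply: norm_cvg0.
  apply: (@squeeze_cvgr _ _ _ _ (cst 0)
    (fun x => C * fine (normal_prob 0 2 `]x, +oo[))); last 2 first.
  + exact: cvg_cst.
  + rewrite -[X in _ --> X](mulr0 C); apply: cvgMl_tmp.
    exact: (cvg_integral_normal_pdf 2).1.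
  near=> x; rewrite normr_ge0/=.
  have /eqP : \int[mu]_t rho t = 0 by rewrite /Rintegral int0.
  rewrite -(itv_setU_setT false x) Rintegral_setU//=; last 2 first.
  + by rewrite itv_setU_setT.
  + exact: disjoint_rays.
  by rewrite addr_eq0 => /eqP; rewrite -/(F x) => ->; rewrite normrN; exact: bound.
- apply: norm_cvg0.
  apply: (@squeeze_cvgr _ _ _ _ (cst 0)
    (fun x => C * fine (normal_prob 0 2 `]-oo, (- x)]))); last 2 first.
  + exact: cvg_cst.
  + rewrite -[X in _ --> X](mulr0 C); apply: cvgMl_tmp.
    exact: (cvg_integral_normal_pdf 2).2.
  by near=> x; rewrite normr_ge0/=; exact: bound.
Unshelve. all: by end_near. Qed.

End gaussian.

(** * The Stein equation *)

Section stein_solution.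
Variable R : realType.
Notation mu := (@lebesgue_measure R).
Notation phi := (@normal_pdf R 0 1).

Lemma normal_pdfN (x : R) : phi (- x) = phi x.
Proof. by rewrite !centered_normal_pdfE ?oner_eq0// sqrrN. Qed.

(** The integrating factor is phi: the derivative of phi * g is phi * k, and
    K * phi x <= K / a * (x * phi x) beyond a, so that the Gaussian tail bound
    applies to phi * g at a. *)
Lemma drift_le (g k : R -> R) (B K : R) :
  (forall x : R, is_derive x 1 g (x * g x + k x)) ->
  (forall x, `|k x| <= K) -> (forall x, `|g x| <= B * (1 + `|x|)) ->
  forall x, 0 < x -> `|x * g x| <= K.
Proof.
move=> dg kK gB a a0.
have [C C0 HC] := normal_pdf_domination R.
have B0 : 0 <= B.
  by have := gB 0; rewrite normr0 addr0 mulr1; exact: le_trans.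
have K0 : 0 <= K by exact: le_trans (kK 0).
have phi0 x : 0 < phi x by rewrite centered_normal_pdf_gt0 ?oner_eq0.
have : `|phi a * g a| <= K / a * phi a.
  apply: (@gaussian_tail_le R (fun x => phi x * g x) (fun x => phi x * k x)).
  - exact: ltW.
  - move=> x _.
    apply: (is_derive_eq (is_derive_mulf (is_derive_normal_pdf x) (dg x))).
    by ring.
  - move=> x ax; rewrite normrM (gtr0_norm (phi0 x)) mulrA.
    rewrite [leRHS]mulrC ler_wpM2l ?(ltW (phi0 x))// (le_trans (kK x))//.
    by rewrite mulrAC ler_pdivlMr// ler_wpM2l.
  - apply: norm_cvg0.
    apply: (@squeeze_cvgr _ _ _ _ (cst 0) (fun x => B * (C * normal_pdf 0 2 x))).
    + near=> x; rewrite normr_ge0/= normrM (gtr0_norm (phi0 x)).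
      apply: (le_trans (ler_wpM2l (ltW (phi0 x)) (gB x))).
      by rewrite mulrCA ler_wpM2l// mulrC.
    + exact: cvg_cst.
    + rewrite -[X in _ --> X](mulr0 B); apply: cvgMl_tmp.
      rewrite -[X in _ --> X](mulr0 C); apply: cvgMl_tmp.
      exact: cvg_normal_pdfy.
rewrite normrM (gtr0_norm (phi0 a)) mulrC ler_pM2r// ler_pdivlMr// mulrC.
by rewrite normrM (gtr0_norm a0).
Unshelve. all: by end_near. Qed.

(** On the negative side, x |-> g (- x) solves the equation with
    right-hand side - k (- x). *)
Lemma drift_bound (g k : R -> R) (B K : R) :
  (forall x : R, is_derive x 1 g (x * g x + k x)) ->
  (forall x, `|k x| <= K) -> (forall x, `|g x| <= B * (1 + `|x|)) ->
  forall x, `|x * g x| <= K.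
Proof.
move=> dg kK gB x; have [x0|x0|<-] := ltgtP 0 x; first 1 last.
- rewrite -normrN -mulNr -[x in g x]opprK.
  apply: (@drift_le (fun y => g (- y)) (fun y => - k (- y)) B).
  + move=> y; have := is_derive_reflect (dg (- y)).
    by rewrite opprD mulNr opprK.
  + by move=> y; rewrite normrN.
  + by move=> y; rewrite -(normrN y).
  + by rewrite oppr_gt0.
- by rewrite mul0r normr0 (le_trans _ (kK 0)).
exact: (@drift_le g k B).
Qed.

(** The solution is f = F / phi with F the primitive of (h - c) * phi vanishing
    at both ends. Writing f1, f2, f3 for its successive derivatives, one has
    f2 - x f1 - f = h1 and f3 - x f2 - 2 f1 = h2. Each is an Ornstein-Uhlenbeck
    equation, for f and for f1, and the last one is also a first-order equation
    for f2. *)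
Lemma stein_equation (h h1 h2 : R -> R) :
  (forall x : R, is_derive x 1 h (h1 x)) ->
  (forall x : R, is_derive x 1 h1 (h2 x)) ->
  (forall x, `|h1 x| <= 1) -> (forall x, `|h2 x| <= 1) ->
  exists f f1 f2 : R -> R,
    [/\ (forall x : R, is_derive x 1 f (f1 x)) /\
        (forall x : R, is_derive x 1 f1 (f2 x)),
      forall x, f1 x - x * f x = h x - \int[normal_prob 0 1]_y h y,
      (forall x, `|f x| <= 1) /\ (forall x, `|f1 x| <= 1 / 2),
      continuous f2 /\ (forall x, `|f2 x| <= 5 / 2) &
      forall x y, `|f2 x - f2 y| <= 4 * `|x - y|].
Proof.
move=> dh dh1 h1b h2b.
set c := \int[normal_prob 0 1]_y h y.
have ch := is_derive_continuous dh.
have mh : measurable_fun setT h := continuous_measurable_fun ch.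
pose A := `|h 0| + `|c| + 1.
have A0 : 0 <= A by rewrite !addr_ge0.
have hA x : `|h x - c| <= A * (1 + `|x|).
  rewrite (le_trans (ler_normB _ _))//.
  apply: (le_trans (lerD (linear_growth dh h1b x) (lexx _))).
  rewrite /A; have := normr_ge0 (h 0); have := normr_ge0 c; have := normr_ge0 x.
  nra.
have ih : (normal_prob 0 1).-integrable setT (EFin \o (fun x => h x - c)).
  by apply: integrable_normal_prob hA; exact: measurable_funB.
have ih0 : (normal_prob 0 1).-integrable setT (EFin \o h).
  apply: (@integrable_normal_prob R _ (`|h 0| + 1)) => // x.
  apply: (le_trans (linear_growth dh h1b x)).
  have := normr_ge0 (h 0); have := normr_ge0 x; nra.
have phi0 x : 0 < phi x by rewrite centered_normal_pdf_gt0 ?oner_eq0.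
have [C C0 HC] := normal_pdf_domination R.
pose rho x := (h x - c) * phi x.
have rhoE x : `|rho x| = `|h x - c| * phi x.
  by rewrite normrM (gtr0_norm (phi0 x)).
have int_rho : (\int[mu]_x (rho x)%:E = 0)%E.
  under eq_integral do rewrite EFinM.
  rewrite -integral_normal_prob//.
  have ic : (normal_prob 0 1).-integrable [set: R] (EFin \o cst c).
    exact: finite_measure_integrable_cst.
  have int_h : \int[normal_prob 0 1]_x (h x - c) = 0.
    have PT : normal_prob 0 1 [set: R] = 1%E := probability_setT (normal_prob 0 1).
    rewrite RintegralB// Rintegral_cst// (_ : fine _ = 1) ?mulr1 ?subrr//.
    by rewrite -[RHS]/(fine 1%E); congr fine; exact: PT.
  rewrite -[LHS]fineK; last exact: integrable_fin_num.
  by congr EFin; exact: int_h.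
have crho : continuous rho.
  move=> x; apply: cvgM; last by apply: continuous_normal_pdf; rewrite oner_eq0.
  by apply: cvgB; [exact: ch|exact: cvg_cst].
have [F [dF Fy FNy]] : exists F : R -> R, [/\ forall x : R, is_derive x 1 F (rho x),
    F x @[x --> +oo] --> 0 & F (- x) @[x --> +oo] --> 0].
  apply: (@primitive_vanishing R _ (A * C)) => // x.
  rewrite rhoE (le_trans (ler_wpM2r (ltW (phi0 x)) (hA x)))//.
  by rewrite -!mulrA ler_wpM2l.
have hA1 x : 1 <= `|x| -> `|h x - c| <= 2 * A * `|x|.
  by move=> x1; rewrite (le_trans (hA x))//; nra.
have F1 x : 1 <= x -> `|F x| <= 2 * A * phi x /\ `|F (- x)| <= 2 * A * phi x.
  move=> x1; have x0 : 0 <= x by exact: le_trans x1.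
  split.
    apply: (gaussian_tail_le x0 (fun y _ => dF y)) => // y xy.
    have y1 := le_trans x1 xy; have y0 : 0 < y by exact: lt_le_trans y1.
    rewrite rhoE mulrA ler_pM2r//.
    by have := hA1 y; rewrite gtr0_norm//; exact.
  apply: (gaussian_tail_le x0 (fun y _ => is_derive_reflect (dF (- y)))) => // y xy.
  have y1 := le_trans x1 xy; have y0 : 0 < y by exact: lt_le_trans y1.
  rewrite normrN rhoE normal_pdfN mulrA ler_pM2r//.
  by have := hA1 (- y); rewrite normrN gtr0_norm//; exact.
pose f x := F x / phi x.
pose f1 x := x * f x + (h x - c).
pose f2 x := f x + x * f1 x + h1 x.
pose f3 x := x * f2 x + (2 * f1 x + h2 x).
have df (x : R) : is_derive x 1 f (f1 x).
  have phin : phi x != 0 by rewrite gt_eqF.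
  apply: (is_derive_eq (is_derive_mulf (dF x)
    (is_deriveV phin (is_derive_normal_pdf x)))).
  by rewrite /f1 /f /rho /GRing.scale/=; field.
have df1 (x : R) : is_derive x 1 f1 (f2 x).
  apply: (is_derive_eq (is_derive_addf (is_derive_mulf (is_derive_id x 1) (df x))
    (is_derive_subf (dh x) (is_derive_cst c x 1)))).
  by rewrite /f2; ring.
have df2 (x : R) : is_derive x 1 f2 (f3 x).
  apply: (is_derive_eq (is_derive_addf (is_derive_addf (df x)
    (is_derive_mulf (is_derive_id x 1) (df1 x))) (dh1 x))).
  by rewrite /f3; ring.
have f_tail x : 1 <= `|x| -> `|f x| <= 2 * A.
  move=> x1; rewrite normrM normfV (gtr0_norm (phi0 x)) ler_pdivrMr//.
  have [x0|x0] := leP 0 x.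
    by apply: (F1 _ _).1; rewrite ger0_norm in x1.
  by rewrite -[x]opprK normal_pdfN; apply: (F1 _ _).2; rewrite ltr0_norm in x1.
have f_bound x : `|f x| <= 1.
  rewrite -[leRHS](divr1 1).
  apply: (@ornstein_uhlenbeck_max _ f f1 f2 h1 1 1 (2 * A)) => // y.
  - move=> y1; rewrite (le_trans (f_tail y y1))//; nra.
  - by rewrite /f2; ring.
have f1_bound x : `|f1 x| <= 1 / 2.
  apply: (@ornstein_uhlenbeck_max _ f1 f2 f3 h2 2 1 (1 + 2 * A)) => // y.
  - move=> y1; rewrite (le_trans (ler_normD _ _))// mulrDl lerD ?hA1//.
    by rewrite normrM mulrC ler_wpM2r.
  - by rewrite /f3; ring.
have k_bound x : `|2 * f1 x + h2 x| <= 2.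
  rewrite (le_trans (ler_normD _ _))// normrM ger0_norm//.
  by have := f1_bound x; have := h2b x; lra.
have f2_growth x : `|f2 x| <= 2 * (1 + `|x|).
  rewrite (le_trans (ler_normD _ _))//.
  rewrite (le_trans (lerD (ler_normD _ _) (lexx _)))// [`|x * _|]normrM.
  have := ler_wpM2l (normr_ge0 x) (f1_bound x).
  have := f_bound x; have := h1b x; have := normr_ge0 x; lra.
have xf2 x : `|x * f2 x| <= 2.
  exact: (@drift_bound f2 (fun x => 2 * f1 x + h2 x) 2).
exists f, f1, f2; split => //.
- by move=> x; rewrite /f1; ring.
- split=> [|x]; first exact: is_derive_continuous df2.
  have [x1|x1] := leP 1 `|x|.
    by have := xf2 x; rewrite normrM; have := normr_ge0 (f2 x); nra.
  rewrite (le_trans (ler_normD _ _))//.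
  rewrite (le_trans (lerD (ler_normD _ _) (lexx _)))// [`|x * _|]normrM.
  have := ler_wpM2r (normr_ge0 (f1 x)) (ltW x1).
  have := f_bound x; have := f1_bound x; have := h1b x; lra.
- move=> x y; have [z _ ->] := mean_value y x df2.
  rewrite normrM ler_wpM2r// (le_trans (ler_normD _ _))//.
  by have := xf2 z; have := k_bound z; lra.
Qed.

End stein_solution.

(** * Independence *)

Section independence.
Context (R : realType) (d : measure_display) (T : measurableType d)
  (P : probability T R).

Definition independent_pair (U V : T -> R) := forall A B : set R,
  measurable A -> measurable B ->
  P (U @^-1` A `&` V @^-1` B) = (P (U @^-1` A) * P (V @^-1` B))%E.

Lemma independent_pair_comp (U V : T -> R) (f g : R -> R) :
  measurable_fun setT f -> measurable_fun setT g ->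
  independent_pair U V -> independent_pair (f \o U) (g \o V).
Proof.
move=> mf mg indep A B mA mB.
apply: (indep (f @^-1` A) (g @^-1` B)).
  by rewrite -[X in measurable X]setTI; exact: mf.
by rewrite -[X in measurable X]setTI; exact: mg.
Qed.

(** Independence says that the joint law agrees with the product of the marginal
    laws on rectangles, hence everywhere; the rest is Fubini's theorem. *)
Lemma independent_pair_Rintegral (f g : T -> R) :
  independent_pair f g ->
  P.-integrable setT (EFin \o f) -> P.-integrable setT (EFin \o g) ->
  P.-integrable setT (EFin \o (fun w => f w * g w)) /\
  \int[P]_w (f w * g w) = (\int[P]_w f w) * (\int[P]_w g w).
Proof.
move=> indep iU iV.
have mf : measurable_fun setT f by exact/measurable_EFinP/(measurable_int P).
have mg : measurable_fun setT g by exact/measurable_EFinP/(measurable_int P).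
pose U : {RV P >-> R} := HB.pack f (@isMeasurableFun.Build _ _ T R _ mf).
pose V : {RV P >-> R} := HB.pack g (@isMeasurableFun.Build _ _ T R _ mg).
have mUV : measurable_fun setT (fun w => (U w, V w)) by exact: measurable_fun_pair.
pose W : {RV P >-> (R * R)%type} := HB.pack (fun w => (U w, V w))
  (@isMeasurableFun.Build _ _ T (R * R)%type _ mUV).
have lawE (h : R * R -> \bar R) :
    (\int[distribution P W]_z h z = \int[distribution P U \x distribution P V]_z h z)%E.
  apply: eq_measure_integral => A mA _; symmetry.
  by apply: product_measure_unique.
have mprod : measurable_fun setT (fun z : R * R => (z.1 * z.2)%:E).
  by apply/measurable_EFinP; exact: measurable_funM.
have mU : measurable_fun setT (EFin \o U) by exact/measurable_EFinP.
have mV : measurable_fun setT (EFin \o V) by exact/measurable_EFinP.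
have iabs (X : {RV P >-> R}) : P.-integrable setT (EFin \o X) ->
    (\int[distribution P X]_x `|x%:E| < +oo)%E.
  move=> /integrableP[mX]; rewrite ge0_integral_distribution//.
  exact: measurableT_comp.
have iid (X : {RV P >-> R}) : P.-integrable setT (EFin \o X) ->
    (distribution P X).-integrable setT (EFin : R -> \bar R).
  by move=> iX; apply/integrableP; split => //; exact: iabs.
have iUV : (distribution P U \x distribution P V)%E.-integrable setT
    (fun z : R * R => (z.1 * z.2)%:E).
  apply/integrable12ltyP => //.
  under eq_integral => x _.
    under eq_integral => y _ do rewrite /= normrM EFinM.
    rewrite ge0_integralZl//; last by exact: measurableT_comp.
    over.
  rewrite ge0_integralZr//; last 2 first.
  - exact: measurableT_comp.
  - exact: integral_ge0.
  by rewrite lte_mul_pinfty ?integral_ge0 ?iabs// ge0_fin_numE ?integral_ge0 ?iabs.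
have iP : P.-integrable setT (EFin \o (fun w => U w * V w)).
  apply/integrableP; split; first by apply/measurable_EFinP; exact: measurable_funM.
  have /integrableP[_] := iUV.
  rewrite -lawE ge0_integral_distribution//; exact: measurableT_comp.
split => //.
rewrite /Rintegral -fineM; last 2 first.
- exact: integrable_fin_num.
- exact: integrable_fin_num.
congr fine.
transitivity (\int[distribution P W]_z (z.1 * z.2)%:E)%E.
  by rewrite integral_distribution.
rewrite lawE -integral12_prod_meas1//=.
under eq_integral => x _.
  rewrite /fubini_F/=.
  under eq_integral => y _ do rewrite EFinM.
  rewrite integralZl//; last exact: iid.
  over.
have fV : (\int[distribution P V]_y y%:E)%E \is a fin_num.
  exact/integrable_fin_num/iid.
rewrite -(fineK fV) integralZr//; last exact: iid.
by rewrite fineK// !integral_distribution.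
Qed.

End independence.

Section leave_one_out.
Context (R : realType) (d : measure_display) (T : measurableType d)
  (P : probability T R).

(** Both sides are finite measures in the second event, and two finite measures
    of the same mass which agree on a pi-system agree on the sigma-algebra it
    generates. *)
Lemma pi_system_independence (G : set (set T)) (A E : set T) :
  measurable A -> G `<=` measurable -> setI_closed G ->
  (forall B, G B -> P (A `&` B) = (P A * P B)%E) ->
  <<s G >> E -> P (A `&` E) = (P A * P E)%E.
Proof.
move=> mA Gm GI indep GE.
have HG : [set X | G X /\ X `<=` setT] = G.
  by apply/seteqP; split => X /=; [case|split].
pose a : {nonneg R} := NngNum (fine_ge0 (measure_ge0 P A)).
have aE B : mscale a P B = (P A * P B)%E.
  by rewrite /mscale/= fineK// fin_num_measure.
have restrE B : mrestr P mA B = P (A `&` B) by rewrite /mrestr setIC.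
rewrite -restrE -aE.
apply: (@g_sigma_algebra_measure_unique_trace _ _ _ G setT) => //.
- by rewrite HG.
- by rewrite HG.
- apply: etrans (restrE _) (etrans _ (esym (aE _))).
  by rewrite setIT probability_setT mule1.
- move=> B [/indep indepB _].
  exact: etrans (restrE _) (etrans indepB (esym (aE _))).
- have : (mrestr P mA setT < +oo)%E.
    by rewrite restrE setIT -ge0_fin_numE// fin_num_measure.
  exact.
- by rewrite HG.
Qed.

(** The sum is measurable for the sigma-algebra generated by the cylinders over
    the variables other than X k, and these cylinders form a pi-system, on which
    the product rule is the hypothesis of mutual independence. *)
Lemma independent_leave_one_out (n : nat) (X : 'I_n -> {RV P >-> R}) (k : 'I_n)
    (g : 'I_n -> R -> R) : (forall j, measurable_fun setT (g j)) ->
  mutually_independent X ->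
  independent_pair P (X k) (fun w => \sum_(j < n | j != k) g j (X j w)).
Proof.
move=> mg indep A B mA mB.
pose cylinder (C : 'I_n -> set R) :=
  \bigcap_(j in [set` (~: [set k])%SET]) (X j @^-1` C j).
pose G : set (set T) :=
  [set E | exists2 C, (forall j, measurable (C j)) & E = cylinder C].
have mX j C : measurable C -> measurable (X j @^-1` C).
  by move=> mC; rewrite -[X in measurable X]setTI; exact: measurable_funP.
have V_G : <<s G >> ((fun w => \sum_(j < n | j != k) g j (X j w)) @^-1` B).
  pose T' := g_sigma_algebraType G.
  have mXG j : j != k -> measurable_fun setT (X j : T' -> R).
    move=> jk _ C mC; rewrite setTI; apply: sub_sigma_algebra.
    exists (fun i => if i == j then C else setT) => [i|]; first by case: ifP.
    apply/seteqP; split => w /=; last first.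
      by move=> /(_ j); rewrite /= eqxx; apply; rewrite finset.in_setC finset.in_set1.
    by move=> Cw i _ /=; case: eqP => [->|].
  have : measurable_fun setT ((fun w => \sum_(j < n | j != k) g j (X j w)) : T' -> R).
    under eq_fun => w do rewrite big_mkcond.
    apply: measurable_sum => j; case jk : (j != k); last exact: measurable_cst.
    by apply: measurableT_comp (mg j) (mXG j jk).
  by move=> /(_ measurableT B mB); rewrite setTI.
apply: pi_system_independence V_G.
- exact: mX.
- by move=> _ [C mC ->]; apply: fin_bigcap_measurable => // j _; exact: mX.
- move=> _ _ [C1 mC1 ->] [C2 mC2 ->]; exists (fun j => C1 j `&` C2 j).
    by move=> j; exact: measurableI.
  by rewrite /cylinder -bigcapI; apply: eq_bigcapr => j _; rewrite preimage_setI.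
- move=> _ [C mC ->].
  pose D j := if j == k then A else C j.
  have mD j : measurable (D j) by rewrite /D; case: ifP.
  have -> : X k @^-1` A `&` cylinder C = \bigcap_(j in [set` [set: 'I_n]%SET]) (X j @^-1` D j).
    apply/seteqP; split => w /=.
      move=> [Aw Cw] j _ /=; rewrite /D; case: eqP => [->//|/eqP jk].
      by apply: Cw; rewrite /= finset.in_setC finset.in_set1.
    move=> Dw; split.
      by have := Dw k; rewrite /= /D eqxx; apply; rewrite finset.in_setT.
    move=> j; rewrite /= finset.in_setC finset.in_set1 => jk.
    by have := Dw j; rewrite /= /D (negbTE jk); apply; rewrite finset.in_setT.
  rewrite indep// /cylinder indep//.
  rewrite (bigD1 k) ?finset.in_setT//= {1}/D eqxx; congr (_ * _)%E.
  apply: eq_big => [j|j /andP[_ jk]]; first by rewrite finset.in_setT finset.in_setC finset.in_set1.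
  by rewrite /D (negbTE jk).
Qed.

End leave_one_out.

(** * Moments *)

Section moments.
Context (R : realType) (d : measure_display) (T : measurableType d)
  (P : probability T R).
Implicit Types f g Z : T -> R.
Local Notation L1 f := (P.-integrable setT (EFin \o f)).

Lemma L1_dominated f g : measurable_fun setT f -> L1 g ->
  (forall w, `|f w| <= g w) -> L1 f.
Proof.
move=> mf ig fg; apply: (le_integrable _ _ _ ig) => //; first exact/measurable_EFinP.
by move=> w _; rewrite /= lee_fin (le_trans (fg w))// ler_norm.
Qed.

Lemma L1_bounded f (B : R) : measurable_fun setT f -> (forall w, `|f w| <= B) -> L1 f.
Proof.
by move=> mf fB; apply: (L1_dominated mf (finite_measure_integrable_cst P B measurableT)).
Qed.

Lemma norm_Rintegral_le f g : L1 f -> L1 g -> (forall w, `|f w| <= g w) ->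
  `|\int[P]_w f w| <= \int[P]_w g w.
Proof.
move=> lf lg fg; apply: (le_trans (le_normr_Rintegral measurableT lf)).
by apply: le_Rintegral => //; exact: integrable_norm.
Qed.

Lemma powR_le1D (x s p : R) : 0 <= x -> 0 <= s <= p -> x `^ s <= 1 + x `^ p.
Proof.
move=> x0 /andP[s0 sp]; have [x1|x1] := leP x 1.
  apply: (@le_trans _ _ 1); last by rewrite lerDl powR_ge0.
  by have := ge0_ler_powR s0 x0 (ler01 : 1 \in Num.nneg) x1; rewrite powR1.
by apply: (@le_trans _ _ (x `^ p)); rewrite ?lerDr// ler_powR// ltW.
Qed.

Lemma measurable_normpowR Z (s : R) : measurable_fun setT Z ->
  measurable_fun setT (fun w => `|Z w| `^ s).
Proof.
move=> mZ; apply: (measurableT_comp (measurable_powR s)).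
exact: measurableT_comp.
Qed.

(** Lower moments are controlled by higher ones since x^s <= 1 + x^p. *)
Lemma L1_powR Z (s p : R) : measurable_fun setT Z -> 0 <= s <= p ->
  L1 (fun w => `|Z w| `^ p) -> L1 (fun w => `|Z w| `^ s).
Proof.
move=> mZ sp ip.
apply: (@L1_dominated _ (fun w => 1 + `|Z w| `^ p)).
- exact: measurable_normpowR.
- have := integrableD measurableT (finite_measure_integrable_cst P 1 measurableT) ip.
  by apply.
- by move=> w; rewrite ger0_norm ?powR_ge0// powR_le1D.
Qed.

(** Chebyshev's association inequality. With c chosen so that c^t = E|Z|^t, the
    product (|Z|^s - c^s) * (|Z|^t - c^t) is nonnegative, both factors having the
    sign of |Z| - c; its expectation is
    E|Z|^(s + t) - E|Z|^s * E|Z|^t. *)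
Lemma association_moments Z (s t : R) : measurable_fun setT Z -> 0 < s -> 0 < t ->
  L1 (fun w => `|Z w| `^ (s + t)) ->
  (\int[P]_w (`|Z w| `^ s)) * (\int[P]_w (`|Z w| `^ t)) <=
  \int[P]_w (`|Z w| `^ (s + t)).
Proof.
move=> mZ s0 t0 ist.
have is_ : L1 (fun w => `|Z w| `^ s).
  by apply: L1_powR ist => //; rewrite ltW//= lerDl ltW.
have it : L1 (fun w => `|Z w| `^ t).
  by apply: L1_powR ist => //; rewrite ltW//= lerDr ltW.
have mom_ge0 r : 0 <= \int[P]_w (`|Z w| `^ r).
  by apply: Rintegral_ge0 => w _; exact: powR_ge0.
set S := \int[P]_w (`|Z w| `^ s); set U := \int[P]_w (`|Z w| `^ t).
pose c := U `^ t^-1.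
have c0 : 0 <= c by exact: powR_ge0.
have ct : c `^ t = U by rewrite /c -powRrM mulVf ?gt_eqF// powRr1//; exact: mom_ge0.
have pointwise w : `|Z w| `^ s * U + c `^ s * `|Z w| `^ t <=
    `|Z w| `^ (s + t) + c `^ s * U.
  rewrite powRD; last by rewrite gt_eqF// addr_gt0.
  rewrite -ct; set x := `|Z w|; have x0 : 0 <= x by exact: normr_ge0.
  rewrite -subr_ge0 (_ : _ - _ = (x `^ s - c `^ s) * (x `^ t - c `^ t)); last by ring.
  have [xc|/ltW cx] := leP x c.
    by apply: mulr_le0; rewrite subr_le0; apply: ge0_ler_powR => //; exact: ltW.
  by apply: mulr_ge0; rewrite subr_ge0; apply: ge0_ler_powR => //; exact: ltW.
have i1 : L1 (fun w => `|Z w| `^ s * U).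
  by have := integrableZr measurableT U is_; apply.
have i2 : L1 (fun w => c `^ s * `|Z w| `^ t).
  by have := integrableZl measurableT (c `^ s) it; apply.
have i3 : L1 (fun=> c `^ s * U) by exact: finite_measure_integrable_cst.
have : \int[P]_w (`|Z w| `^ s * U + c `^ s * `|Z w| `^ t) <=
    \int[P]_w (`|Z w| `^ (s + t) + c `^ s * U).
  apply: le_Rintegral => //.
  - by have := integrableD measurableT i1 i2; apply.
  - by have := integrableD measurableT ist i3; apply.
rewrite !RintegralD// RintegralZr// RintegralZl// -/S -/U Rintegral_cst//.
rewrite (_ : fine _ = 1) ?mulr1 ?lerD2r//.
exact: (congr1 fine (probability_setT P)).
Qed.

End moments.

(** * Taylor expansion with Hoelder remainder *)

Section taylor.
Variable R : realType.
Implicit Types f g : R -> R.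

Lemma mean_value_le f f' (a b K : R) : (forall x : R, is_derive x 1 f (f' x)) ->
  (forall c, `|c - a| <= `|b - a| -> `|f' c| <= K) ->
  `|f b - f a| <= K * `|b - a|.
Proof.
move=> df fK; have [c cab ->] := mean_value a b df.
by rewrite normrM ler_wpM2r// fK.
Qed.

Lemma powR_normD (z s t : R) : 0 < s -> 0 < t ->
  `|z| `^ (s + t) = `|z| `^ s * `|z| `^ t.
Proof. by move=> s0 t0; rewrite powRD// gt_eqF// addr_gt0. Qed.

Lemma taylor1_hoelder g g1 (M r : R) : 0 <= M -> 0 < r ->
  (forall x : R, is_derive x 1 g (g1 x)) ->
  (forall x y, `|g1 x - g1 y| <= M * `|x - y| `^ r) ->
  forall x z, `|g (x + z) - g x - z * g1 x| <= M * `|z| `^ (1 + r).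
Proof.
move=> M0 r0 dg gM x z.
have dpsi (y : R) : is_derive y 1 (fun y => g y - y * g1 x) (g1 y - g1 x).
  apply: (is_derive_eq (is_derive_subf (dg y)
    (is_derive_mulf (is_derive_id y 1) (is_derive_cst (g1 x) y 1)))).
  by rewrite mul1r mulr0 addr0.
have dz : x + z - x = z by rewrite addrC addKr.
rewrite (_ : g (x + z) - g x - z * g1 x =
  (g (x + z) - (x + z) * g1 x) - (g x - x * g1 x)); last by ring.
have -> : M * `|z| `^ (1 + r) = M * `|z| `^ r * `|x + z - x|.
  by rewrite dz powR_normD// powRr1// mulrAC mulrA.
apply: (mean_value_le dpsi) => c; rewrite dz => cz.
by rewrite (le_trans (gM _ _))// ler_wpM2l// ge0_ler_powR// ltW.
Qed.

(** A Hoelder condition on the second derivative replaces a bound on the third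
    one, so that the remainder is of order 2 + r and the moment of order 3 + r
    suffices after multiplication by Z. *)
Lemma taylor2_hoelder f f1 f2 (M r : R) : 0 <= M -> 0 < r ->
  (forall x : R, is_derive x 1 f (f1 x)) ->
  (forall x : R, is_derive x 1 f1 (f2 x)) ->
  (forall x y, `|f2 x - f2 y| <= M * `|x - y| `^ r) ->
  forall x z, `|f (x + z) - f x - z * f1 x - z ^+ 2 / 2 * f2 x| <=
    M * `|z| `^ (2 + r).
Proof.
move=> M0 r0 df df1 fM x z.
have dsub (y : R) : is_derive y 1 (fun y => y - x) (1 - 0).
  exact: (is_derive_subf (is_derive_id y 1) (is_derive_cst x y 1)).
have dpsi (y : R) :
    is_derive y 1 (fun y => f y - y * f1 x - (y - x) * (y - x) * (f2 x / 2))
    (f1 y - f1 x - (y - x) * f2 x).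
  apply: (is_derive_eq (is_derive_subf (is_derive_subf (df y)
    (is_derive_mulf (is_derive_id y 1) (is_derive_cst (f1 x) y 1)))
    (is_derive_mulf (is_derive_mulf (dsub y) (dsub y))
      (is_derive_cst (f2 x / 2) y 1)))).
  by rewrite /=; field.
have dz : x + z - x = z by rewrite addrC addKr.
rewrite (_ : f (x + z) - f x - z * f1 x - z ^+ 2 / 2 * f2 x =
  (f (x + z) - (x + z) * f1 x - (x + z - x) * (x + z - x) * (f2 x / 2)) -
  (f x - x * f1 x - (x - x) * (x - x) * (f2 x / 2))); last by field.
have -> : M * `|z| `^ (2 + r) = M * `|z| `^ (1 + r) * `|x + z - x|.
  have -> : 2 + r = (1 + r) + 1 by ring.
  by rewrite dz (powR_normD z (addr_gt0 ltr01 r0) ltr01) powRr1// mulrA.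
apply: (mean_value_le dpsi) => c; rewrite dz => cz.
have := @taylor1_hoelder f1 f2 M r M0 r0 df1 fM x (c - x).
rewrite subrKC => /le_trans; apply; rewrite ler_wpM2l// ge0_ler_powR//.
by rewrite addr_ge0// ltW.
Qed.

End taylor.

(** * Expansion of the Stein discrepancy *)

Section leave_one_out_expansion.
Context (R : realType) (d : measure_display) (T : measurableType d)
  (P : probability T R).
Local Notation L1 f := (P.-integrable setT (EFin \o f)).
Local Notation E f := (\int[P]_w f w).

Lemma RintegralD_L1 (f g : T -> R) : L1 f -> L1 g ->
  L1 (fun w => f w + g w) /\ E (fun w => f w + g w) = E f + E g.
Proof.
move=> lf lg; split; last by rewrite RintegralD.
by have := integrableD measurableT lf lg; apply.
Qed.

Lemma RintegralZ_L1 (c : R) (f : T -> R) : L1 f ->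
  L1 (fun w => c * f w) /\ E (fun w => c * f w) = c * E f.
Proof.
move=> lf; split; last by rewrite RintegralZl.
by have := integrableZl measurableT c lf; apply.
Qed.

Lemma L1_exprn (Z : T -> R) (m : nat) (p : R) : measurable_fun setT Z ->
  m%:R <= p -> L1 (fun w => `|Z w| `^ p) -> L1 (fun w => Z w ^+ m).
Proof.
move=> mZ mp iZ.
have im : L1 (fun w => `|Z w| `^ m%:R) by apply: L1_powR iZ => //; rewrite ler0n.
apply: L1_dominated im _ => [|w]; first exact: measurable_funX.
by rewrite normrX powR_mulrn.
Qed.

Lemma remainder_le (a b e0 e1 e2 M q1 q2 p3 p : R) :
  0 <= M -> 0 <= a -> `|b| <= p3 -> a * q1 <= p -> p3 * q2 <= p ->
  `|e0| <= M * p -> `|e1| <= M * q1 -> `|e2| <= M * q2 ->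
  `|e0 - a * e1 - b / 2 * e2| <= 5 / 2 * M * p.
Proof.
move=> M0 a0 bp3 aq1 p3q2 h0 h1 h2.
have t1 : `|a * e1| <= M * p.
  rewrite normrM ger0_norm// (le_trans (ler_wpM2l a0 h1))//.
  by rewrite mulrCA ler_wpM2l.
have t2 : `|b / 2 * e2| <= 2^-1 * (M * p).
  rewrite mulrAC normrM mulrC [`|2^-1|]ger0_norm// ler_wpM2l//.
  rewrite normrM (le_trans (ler_pM _ _ bp3 h2))//.
  by rewrite mulrCA ler_wpM2l.
apply: (le_trans (ler_normB _ _)).
apply: (le_trans (lerD (ler_normB _ _) (lexx _))).
lra.
Qed.

(** Write W = V + Z. The expansion of f around V gives, by independence and
    E Z = 0, the main terms E[Z^2] E[f1(V)] and E[Z^3] / 2 * E[f2(V)]. Replacing V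
    by W in both costs one more expansion each: f1 to first order, where the
    linear term vanishes by independence again, and f2 by its Hoelder continuity.
    The resulting products of moments are bounded by the moment of order 3 + r
    through [association_moments]. *)
Lemma leave_one_out_expansion (Z V : T -> R) (f f1 f2 : R -> R) (B M r : R) :
  measurable_fun setT Z -> measurable_fun setT V -> independent_pair P Z V ->
  0 <= M -> 0 < r ->
  L1 (fun w => `|Z w| `^ (3 + r)) -> E Z = 0 ->
  (forall x : R, is_derive x 1 f (f1 x)) ->
  (forall x : R, is_derive x 1 f1 (f2 x)) -> continuous f2 ->
  (forall x, `|f x| <= B) -> (forall x, `|f1 x| <= B) ->
  (forall x, `|f2 x| <= B) ->
  (forall x y, `|f2 x - f2 y| <= M * `|x - y| `^ r) ->
  `|E (fun w => Z w * f (V w + Z w))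
    - E (fun w => Z w ^+ 2) * E (fun w => f1 (V w + Z w))
    - E (fun w => Z w ^+ 3) / 2 * E (fun w => f2 (V w + Z w))|
  <= 5 / 2 * M * E (fun w => `|Z w| `^ (3 + r)).
Proof.
move=> mZ mV indep M0 r0 iZ EZ0 df df1 cf2 fB f1B f2B fM.
have ler : 0 <= r <= 3 + r by lra.
have le1r : 0 <= 1 + r <= 3 + r by lra.
have le3 : 0 <= (3 : R) <= 3 + r by lra.
have mf : measurable_fun setT f := continuous_measurable_fun (is_derive_continuous df).
have mf1 : measurable_fun setT f1 := continuous_measurable_fun (is_derive_continuous df1).
have mf2 : measurable_fun setT f2 := continuous_measurable_fun cf2.
have mW : measurable_fun setT (fun w => V w + Z w) by exact: measurable_funD.
have i1 : L1 Z.
  by apply: (@L1_exprn Z 1 (3 + r)) => //; rewrite mulr1n; lra.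
have i2 : L1 (fun w => Z w ^+ 2) by apply: (@L1_exprn Z 2 (3 + r)) => //; lra.
have i3 : L1 (fun w => Z w ^+ 3) by apply: (@L1_exprn Z 3 (3 + r)) => //; lra.
have pow_id (m : nat) : measurable_fun setT (fun x : R => x ^+ m) by exact: exprn_measurable.
have fV : L1 (fun w => f (V w)) by apply: (@L1_bounded _ _ _ _ _ B) => //; exact: measurableT_comp.
have f1V : L1 (fun w => f1 (V w)) by apply: (@L1_bounded _ _ _ _ _ B) => //; exact: measurableT_comp.
have f2V : L1 (fun w => f2 (V w)) by apply: (@L1_bounded _ _ _ _ _ B) => //; exact: measurableT_comp.
have [iZf eZf] := independent_pair_Rintegral
  (independent_pair_comp (@measurable_id _ R setT) mf indep) i1 fV.
have [iZf2 eZf2] := independent_pair_Rintegral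
  (independent_pair_comp (@measurable_id _ R setT) mf2 indep) i1 f2V.
have [iZ2f1 eZ2f1] := independent_pair_Rintegral
  (independent_pair_comp (pow_id 2) mf1 indep) i2 f1V.
have [iZ3f2 eZ3f2] := independent_pair_Rintegral
  (independent_pair_comp (pow_id 3) mf2 indep) i3 f2V.
rewrite /= EZ0 mul0r in eZf; rewrite /= EZ0 mul0r in eZf2.
pose R0 w := Z w * (f (V w + Z w) - f (V w) - Z w * f1 (V w) - Z w ^+ 2 / 2 * f2 (V w)).
pose R1 w := f1 (V w + Z w) - f1 (V w) - Z w * f2 (V w).
pose R2 w := f2 (V w + Z w) - f2 (V w).
have R0M w : `|R0 w| <= M * `|Z w| `^ (3 + r).
  have -> : 3 + r = 1 + (2 + r) by ring.
  rewrite normrM powR_normD//; last by rewrite addr_gt0.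
  by rewrite powRr1// mulrCA ler_wpM2l// taylor2_hoelder.
have R1M w : `|R1 w| <= M * `|Z w| `^ (1 + r) by exact: taylor1_hoelder.
have R2M w : `|R2 w| <= M * `|Z w| `^ r.
  by apply: (le_trans (fM _ _)); rewrite addrAC subrr add0r.
have mfV : measurable_fun setT (fun w => f (V w)) := measurableT_comp mf mV.
have mf1V : measurable_fun setT (fun w => f1 (V w)) := measurableT_comp mf1 mV.
have mf2V : measurable_fun setT (fun w => f2 (V w)) := measurableT_comp mf2 mV.
have mfW : measurable_fun setT (fun w => f (V w + Z w)) := measurableT_comp mf mW.
have mf1W : measurable_fun setT (fun w => f1 (V w + Z w)) := measurableT_comp mf1 mW.
have mf2W : measurable_fun setT (fun w => f2 (V w + Z w)) := measurableT_comp mf2 mW.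
have ir : L1 (fun w => `|Z w| `^ r) := L1_powR mZ ler iZ.
have i1r : L1 (fun w => `|Z w| `^ (1 + r)) := L1_powR mZ le1r iZ.
have [iMr eMr] := RintegralZ_L1 M ir.
have [iM1r eM1r] := RintegralZ_L1 M i1r.
have [iM3r eM3r] := RintegralZ_L1 M iZ.
have iR0 : L1 R0.
  apply: L1_dominated iM3r R0M.
  apply: measurable_funM => //; apply: measurable_funB; last first.
    by apply: measurable_funM => //; apply: measurable_funM => //; exact: measurable_funX.
  by apply: measurable_funB; [exact: measurable_funB|exact: measurable_funM].
have iR1 : L1 R1.
  apply: L1_dominated iM1r R1M.
  by apply: measurable_funB; [exact: measurable_funB|exact: measurable_funM].
have iR2 : L1 R2 by apply: L1_dominated iMr R2M; exact: measurable_funB.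
have eR0 : `|E R0| <= M * E (fun w => `|Z w| `^ (3 + r)).
  by rewrite -eM3r; exact: norm_Rintegral_le.
have eR1 : `|E R1| <= M * E (fun w => `|Z w| `^ (1 + r)).
  by rewrite -eM1r; exact: norm_Rintegral_le.
have eR2 : `|E R2| <= M * E (fun w => `|Z w| `^ r).
  by rewrite -eMr; exact: norm_Rintegral_le.
have ef : E (fun w => Z w * f (V w + Z w)) =
    E (fun w => Z w ^+ 2) * E (fun w => f1 (V w)) +
    (2^-1 * (E (fun w => Z w ^+ 3) * E (fun w => f2 (V w))) + E R0).
  have [ih eh] := RintegralZ_L1 2^-1 iZ3f2.
  have [ih' eh'] := RintegralD_L1 ih iR0.
  have [ih'' eh''] := RintegralD_L1 iZ2f1 ih'.
  have [_ eh3] := RintegralD_L1 iZf ih''.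
  rewrite -eZ3f2 -eh -eh' -eZ2f1 -eh'' -[RHS]add0r -eZf -eh3.
  by apply: eq_Rintegral => w _; rewrite /R0 /=; field.
have ef1 : E (fun w => f1 (V w + Z w)) = E (fun w => f1 (V w)) + E R1.
  have [ih eh] := RintegralD_L1 iZf2 iR1.
  have [_ eh'] := RintegralD_L1 f1V ih.
  rewrite -[E R1]add0r -eZf2 -eh -eh'.
  by apply: eq_Rintegral => w _; rewrite /R1 /=; ring.
have ef2 : E (fun w => f2 (V w + Z w)) = E (fun w => f2 (V w)) + E R2.
  have [_ eh] := RintegralD_L1 f2V iR2.
  by rewrite -eh; apply: eq_Rintegral => w _; rewrite /R2 /=; ring.
have Z2 : E (fun w => Z w ^+ 2) = E (fun w => `|Z w| `^ 2).
  by apply: eq_Rintegral => w _; rewrite powR_mulrn// real_normK ?num_real.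
have Z3 : `|E (fun w => Z w ^+ 3)| <= E (fun w => `|Z w| `^ 3).
  have i3' : L1 (fun w => `|Z w| `^ 3) := L1_powR mZ le3 iZ.
  by apply: (norm_Rintegral_le i3 i3') => w; rewrite normrX powR_mulrn.
have Z2_ge0 : 0 <= E (fun w => `|Z w| `^ 2).
  by apply: Rintegral_ge0 => w _; exact: powR_ge0.
have a1 := @association_moments _ _ _ P Z 2 (1 + r) mZ (ltr0n _ 2) (addr_gt0 ltr01 r0).
have e3 : 2 + (1 + r) = 3 + r by ring.
rewrite e3 in a1.
have a2 := association_moments mZ (ltr0n _ 3) r0 iZ.
rewrite ef ef1 ef2 Z2.
rewrite (_ : _ - _ - _ = E R0 - E (fun w => `|Z w| `^ 2) * E R1 -
  E (fun w => Z w ^+ 3) / 2 * E R2); last by field.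
exact: (remainder_le M0 Z2_ge0 Z3 (a1 iZ) a2 eR0 eR1 eR2).
Qed.

End leave_one_out_expansion.

Section stein_sum.
Context (R : realType) (d : measure_display) (T : measurableType d)
  (P : probability T R).
Local Notation L1 f := (P.-integrable setT (EFin \o f)).
Local Notation E f := (\int[P]_w f w).

Lemma Rintegral_sum_L1 (I : Type) (s : seq I) (F : I -> T -> R) :
  (forall i, L1 (F i)) ->
  L1 (fun w => \sum_(i <- s) F i w) /\
  E (fun w => \sum_(i <- s) F i w) = \sum_(i <- s) E (F i).
Proof.
move=> iF; elim: s => [|i s [ih eh]].
  under eq_fun do rewrite big_nil.
  rewrite big_nil; split; first exact: finite_measure_integrable_cst.
  by rewrite Rintegral_cst// mul0r.
under eq_fun do rewrite big_cons.
have [iS eS] := RintegralD_L1 (iF i) ih.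
by split; rewrite ?eS ?eh ?big_cons.
Qed.

(** In the expansions of the E[Z_k f(W)] the coefficients of the common factors
    E[f1(W)] and E[f2(W)] add up to 1 and 0. *)
Lemma stein_discrepancy_le (n : nat) (Z : 'I_n -> T -> R) (W : T -> R)
    (f f1 f2 : R -> R) (B M r : R) :
  (forall w, W w = \sum_(k < n) Z k w) ->
  (forall k, measurable_fun setT (Z k)) ->
  (forall k, independent_pair P (Z k) (fun w => \sum_(j < n | j != k) Z j w)) ->
  0 <= M -> 0 < r ->
  (forall k, L1 (fun w => `|Z k w| `^ (3 + r))) ->
  (forall k, E (Z k) = 0) ->
  \sum_(k < n) E (fun w => Z k w ^+ 2) = 1 ->
  \sum_(k < n) E (fun w => Z k w ^+ 3) = 0 ->
  (forall x : R, is_derive x 1 f (f1 x)) ->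
  (forall x : R, is_derive x 1 f1 (f2 x)) -> continuous f2 ->
  (forall x, `|f x| <= B) -> (forall x, `|f1 x| <= B) ->
  (forall x, `|f2 x| <= B) ->
  (forall x y, `|f2 x - f2 y| <= M * `|x - y| `^ r) ->
  `|E (fun w => f1 (W w) - W w * f (W w))|
  <= 5 / 2 * M * \sum_(k < n) E (fun w => `|Z k w| `^ (3 + r)).
Proof.
move=> Wsum mZ indep M0 r0 iZ EZ0 EZ2 EZ3 df df1 cf2 fB f1B f2B fM.
have mW : measurable_fun setT W.
  by rewrite (funext Wsum); exact: measurable_sum.
have mf := continuous_measurable_fun (is_derive_continuous df).
have mf1 := continuous_measurable_fun (is_derive_continuous df1).
pose V k w := \sum_(j < n | j != k) Z j w.
have WE k w : W w = V k w + Z k w by rewrite Wsum (bigD1 k)//= addrC.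
have mV k : measurable_fun setT (V k).
  rewrite (_ : V k = fun w => W w - Z k w); first exact: measurable_funB.
  by apply/funext => w; rewrite (WE k) addrK.
have mfW : measurable_fun setT (fun w => f (W w)) := measurableT_comp mf mW.
have mf1W : measurable_fun setT (fun w => f1 (W w)) := measurableT_comp mf1 mW.
have if1 : L1 (fun w => f1 (W w)) by exact: L1_bounded mf1W (fun w => f1B _).
have le1 : 1%:R <= 3 + r by lra.
have iZ1 k : L1 (Z k) := L1_exprn (mZ k) le1 (iZ k).
have iZf k : L1 (fun w => Z k w * f (W w)).
  apply: (@L1_dominated _ _ _ _ _ (fun w => `|Z k w| * B)).
  - exact: measurable_funM.
  - have := integrableZr measurableT B (integrable_norm (iZ1 k)); exact.
  - by move=> w; rewrite normrM ler_wpM2l.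
have [iS eS] := Rintegral_sum_L1 (index_enum 'I_n) iZf.
have WfE w : W w * f (W w) = \sum_(k < n) Z k w * f (W w) by rewrite {1}Wsum mulr_suml.
under eq_Rintegral do rewrite WfE.
rewrite RintegralB// eS.
set F1 := E (fun w => f1 (W w)); set F2 := E (fun w => f2 (W w)).
have -> : F1 - \sum_(k < n) E (fun w => Z k w * f (W w)) =
    - \sum_(k < n) (E (fun w => Z k w * f (W w)) - E (fun w => Z k w ^+ 2) * F1
       - E (fun w => Z k w ^+ 3) / 2 * F2).
  rewrite !sumrB -!mulr_suml EZ2 EZ3; ring.
rewrite normrN (le_trans (ler_norm_sum _ _ _))// mulr_sumr ler_sum// => k _.
have e0 : E (fun w => Z k w * f (W w)) = E (fun w => Z k w * f (V k w + Z k w)).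
  by apply: eq_Rintegral => w _; rewrite (WE k).
have e1 : F1 = E (fun w => f1 (V k w + Z k w)).
  by apply: eq_Rintegral => w _; rewrite (WE k).
have e2 : F2 = E (fun w => f2 (V k w + Z k w)).
  by apply: eq_Rintegral => w _; rewrite (WE k).
rewrite e0 e1 e2.
exact: (leave_one_out_expansion (mZ k) (mV k) (indep k) M0 r0 (iZ k) (EZ0 k)
  df df1 cf2 fB f1B f2B fM).
Qed.

End stein_sum.

(** * Test functions, normalization and the final bound *)

Section smooth_test_functions.
Variable R : realType.

Lemma C2_is_derive (h : R -> R) : C2 h ->
  (forall x : R, is_derive x 1 h (h^`()%classic x)) /\
  (forall x : R, is_derive x 1 h^`()%classic (h^`(2)%classic x)).
Proof.
move=> [dh dh1 _]; split => x.
  by rewrite derive1E; exact: DeriveDef.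
by rewrite derive1nS derive1n1 derive1E; exact: DeriveDef.
Qed.

Lemma sup_norm_le1 (g : R -> R) : (sup_norm g <= 1)%E -> forall x, `|g x| <= 1.
Proof.
move=> g1 x; rewrite -lee_fin; apply: le_trans g1.
by apply: ereal_sup_ubound; exists x.
Qed.

(** The Lipschitz bound is used at distance at most 1 and the uniform bound
    beyond. *)
Lemma hoelder_of_lipschitz (g : R -> R) (B L r : R) : 0 < r <= 1 ->
  0 <= L -> 0 <= B ->
  (forall x, `|g x| <= B) -> (forall x y, `|g x - g y| <= L * `|x - y|) ->
  forall x y, `|g x - g y| <= Num.max L (2 * B) * `|x - y| `^ r.
Proof.
move=> /andP[r0 r1] L0 B0 gB gL x y; set t := `|x - y|.
have [t0|t0] := eqVneq t 0.
  by have := gL x y; rewrite -/t t0 mulr0 powR0 ?gt_eqF// mulr0.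
have {}t0 : 0 < t by rewrite lt_neqAle eq_sym t0 /t normr_ge0.
have [t1|t1] := leP t 1.
  apply: (le_trans (gL x y)); rewrite -/t.
  apply: ler_pM => //; first exact: ltW.
    by rewrite le_max lexx.
  by rewrite ger1_powR// t0.
apply: (@le_trans _ _ (2 * B)).
  by rewrite (le_trans (ler_normB _ _))// mulr_natl mulr2n lerD.
apply: (@le_trans _ _ (2 * B * t `^ r)).
  rewrite ler_peMr ?mulr_ge0//.
  by have := ge0_ler_powR (ltW r0) (ler01 : 1 \in Num.nneg) (ltW t0 : t \in Num.nneg) (ltW t1); rewrite powR1.
by rewrite ler_wpM2r ?powR_ge0// le_max lexx orbT.
Qed.

(** On the left, 5 is the Hoelder constant of f'' and 5 / 2 collects the three
    remainders of the expansion; on the right, C_ r is at least 8 + 2^3. *)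
Lemma C_ge (r : R) : 0 <= r -> 5 / 2 * 5 <= C_ r.
Proof.
move=> r0; rewrite /C_.
have : 0 <= 2 `^ (2 + r) *
  (3 `^ (r / 3) * (2 + 3 `^ ((3 + r) / 3))) `^ (3 / (3 + r)) :> R.
  by rewrite mulr_ge0 ?powR_ge0.
have : 2 `^ 3%:R <= 2 `^ (4 + r) :> R by rewrite ler_powR//; lra.
rewrite powR_mulrn//; lra.
Qed.

End smooth_test_functions.

Section random_variables.
Context (R : realType) (d : measure_display) (T : measurableType d)
  (P : probability T R).
Local Notation L1 f := (P.-integrable setT (EFin \o f)).
Local Notation E f := (\int[P]_w f w).

Lemma meanE (f : T -> R) : mean P f = E f.
Proof. by rewrite /mean unlock. Qed.

Lemma expectation_EFin (f : T -> R) : L1 f -> ('E_P[f] = (E f)%:E)%E.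
Proof. by move=> lf; rewrite unlock /Rintegral fineK//; exact: integrable_fin_num. Qed.

Lemma varianceE_centered (f : T -> R) : L1 (fun w => centered P f w ^+ 2) ->
  fine 'V_P[f]%E = E (fun w => centered P f w ^+ 2).
Proof.
move=> lf; rewrite /variance unlock -[fine 'E_P[f]]/(mean P f).
by rewrite (_ : _ * _ = (fun w => centered P f w ^+ 2)) ?expectation_EFin//.
Qed.

Lemma powR_normD_le (x y p : R) : 0 <= p ->
  `|x - y| `^ p <= 2 `^ p * (`|x| `^ p + `|y| `^ p).
Proof.
move=> p0; apply: (@le_trans _ _ ((2 * Num.max `|x| `|y|) `^ p)).
  apply: ge0_ler_powR; rewrite ?nnegrE ?mulr_ge0 ?le_max ?normr_ge0//.
  rewrite (le_trans (ler_normB _ _))// mulr_natl mulr2n.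
  by apply: lerD; rewrite le_max lexx ?orbT.
rewrite powRM ?le_max ?normr_ge0// ler_wpM2l ?powR_ge0//.
have := powR_ge0 `|x| p; have := powR_ge0 `|y| p.
by case: (leP `|x| `|y|) => _; lra.
Qed.

Lemma L1_centered_powR (f : T -> R) (p : R) : measurable_fun setT f -> 0 <= p ->
  L1 (fun w => `|f w| `^ p) -> L1 (fun w => `|centered P f w| `^ p).
Proof.
move=> mf p0 lf.
have mc : measurable_fun setT (centered P f) by exact: measurable_funB.
have lm : L1 (fun=> `|mean P f| `^ p) by exact: finite_measure_integrable_cst.
have [l1 _] := RintegralD_L1 lf lm.
have [l2 _] := RintegralZ_L1 (2 `^ p) l1.
apply: L1_dominated l2 _ => [|w]; first exact: measurable_normpowR.
by rewrite ger0_norm ?powR_ge0// powR_normD_le.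
Qed.

Lemma Rintegral_centered (f : T -> R) : L1 f -> E (centered P f) = 0.
Proof.
move=> lf; rewrite /centered RintegralB//; last exact: finite_measure_integrable_cst.
rewrite Rintegral_cst// meanE (_ : fine _ = 1) ?mulr1 ?subrr//.
exact: (congr1 fine (probability_setT P)).
Qed.

End random_variables.

Lemma expectation_standard_normal (R : realType) (d : measure_display)
    (T : measurableType d) (Q : probability T R) (N : {RV Q >-> R})
    (h : R -> R) (A : R) :
  standard_normal N -> measurable_fun setT h ->
  (forall x, `|h x| <= A * (1 + `|x|)) ->
  ('E_Q[h \o N] = (\int[normal_prob 0 1]_y h y)%:E)%E.
Proof.
move=> normalN mh hA.
have ih := integrable_normal_prob mh hA.
have mh' : measurable_fun setT (EFin \o h) by exact/measurable_EFinP.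
(* The law of N lives on R with its canonical measurable structure, the normal
   law on the same sigma-algebra presented as generated by intervals; the
   identity transports one to the other. *)
have mid : @isMeasurableFun _ _ (measurableTypeR R) R idfun.
  by constructor; exact: measurable_id.
pose X : {RV (normal_prob 0 1) >-> R} :=
  HB.pack (idfun : measurableTypeR R -> R) mid.
have lawN (g : R -> \bar R) :
    (\int[distribution Q N]_x g x = \int[distribution (normal_prob 0 1) X]_x g x)%E.
  by apply: eq_measure_integral => B mB _; exact: normalN.
rewrite unlock /Rintegral fineK; last exact: integrable_fin_num.
transitivity (\int[distribution Q N]_x (h x)%:E)%E.
  rewrite integral_distribution//.
  apply/integrableP; split; first exact: (measurableT_comp mh').
  have mah : measurable_fun setT (abse \o (EFin \o h)) by exact: (measurableT_comp _ mh').
  have ah0 y : (0 <= (abse \o (EFin \o h)) y)%E by exact: abse_ge0.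
  apply: (@le_lt_trans _ _ (\int[distribution Q N]_x (abse \o (EFin \o h)) x)%E).
    by rewrite (ge0_integral_distribution _ mah ah0); exact: lexx.
  rewrite lawN (ge0_integral_distribution _ mah ah0).
  by case/integrableP: ih.
by rewrite lawN integral_distribution.
Qed.

Theorem proposition3p1 (R : realType)
    (d : measure_display) (T : measurableType d) (P : probability T R)
    (d' : measure_display) (T' : measurableType d') (Q : probability T' R)
    (N : {RV Q >-> R}) (n : nat) (X : 'I_n -> {RV P >-> R}) (delta : R) :
  standard_normal N ->
  mutually_independent X ->
  0 < delta <= 1 ->
  (forall k : 'I_n, 'E_P[fun w => (`|X k w : R| `^ (3 + delta))%R] < +oo)%E ->
  0 < sigma X ->
  (\sum_(k < n) 'E_P[fun w => (centered P (X k) w ^+ 3)%R] = 0)%E ->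
  (d2 P (fun w => (centered_sum X w / sigma X)%R) Q N
   <= (C_ delta / sigma X `^ (3 + delta))%R%:E *
      \sum_(k < n) 'E_P[fun w => (`|centered P (X k) w| `^ (3 + delta))%R])%E.
Proof.
move=> normalN indep /andP[d0 d1] moments sigma0 third.
set p := 3 + delta.
have p0 : 0 <= p by rewrite /p; lra.
have Xmeas k : measurable_fun setT (X k : T -> R) by exact: measurable_funP.
have ip k : P.-integrable setT (EFin \o (fun w => `|X k w : R| `^ p)).
  apply/integrableP; split.
    by apply/measurable_EFinP; exact: measurable_normpowR.
  have := moments k; rewrite unlock; apply: le_lt_trans.
  by under eq_integral do rewrite /= ger0_norm ?powR_ge0//.
pose Y k := centered P (X k).
have mY k : measurable_fun setT (Y k) by exact: measurable_funB.
have iY k : P.-integrable setT (EFin \o (fun w => `|Y k w| `^ p)).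
  exact: L1_centered_powR.
have le1 : 1%:R <= p by rewrite /p; lra.
have le2 : 2%:R <= p by rewrite /p; lra.
have le3 : 3%:R <= p by rewrite /p; lra.
have iX k : P.-integrable setT (EFin \o (X k : T -> R)) := L1_exprn (Xmeas k) le1 (ip k).
have iY1 k : P.-integrable setT (EFin \o Y k) := L1_exprn (mY k) le1 (iY k).
have iY2 k : P.-integrable setT (EFin \o (fun w => Y k w ^+ 2)) :=
  L1_exprn (mY k) le2 (iY k).
have iY3 k : P.-integrable setT (EFin \o (fun w => Y k w ^+ 3)) :=
  L1_exprn (mY k) le3 (iY k).
set s := sigma X.
pose Z k w := s^-1 * Y k w.
have sN0 : s != 0 by rewrite gt_eqF.
have mZ k : measurable_fun setT (Z k) by exact: measurable_funM.
have ZE k w : `|Z k w| `^ p = (s `^ p)^-1 * `|Y k w| `^ p.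
  rewrite /Z normrM normfV (gtr0_norm sigma0) powRM ?invr_ge0 ?(ltW sigma0)//.
  rewrite -[in LHS](powR_inv1 (ltW sigma0)) -powRrM mulN1r powRN.
  by [].
have iZ k : P.-integrable setT (EFin \o (fun w => `|Z k w| `^ p)).
  rewrite (funext (ZE k)).
  by have [] := RintegralZ_L1 (s `^ p)^-1 (iY k).
have eZ k : \int[P]_w (`|Z k w| `^ p) = (s `^ p)^-1 * \int[P]_w (`|Y k w| `^ p).
  under eq_Rintegral do rewrite ZE.
  by have [_ ->] := RintegralZ_L1 (s `^ p)^-1 (iY k).
have EZ0 k : \int[P]_w Z k w = 0.
  have [_ ->] := RintegralZ_L1 s^-1 (iY1 k).
  by rewrite Rintegral_centered ?mulr0.
have s2 : s ^+ 2 = \sum_(k < n) \int[P]_w (Y k w ^+ 2).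
  have sumE : \sum_(k < n) fine 'V_P[X k]%E = \sum_(k < n) \int[P]_w (Y k w ^+ 2).
    by apply: eq_bigr => k _; exact: (varianceE_centered (iY2 k)).
  rewrite /s /sigma sumE sqr_sqrtr//; apply: sumr_ge0 => k _.
  by apply: Rintegral_ge0 => w _; exact: sqr_ge0.
have EZ2 : \sum_(k < n) \int[P]_w (Z k w ^+ 2) = 1.
  transitivity ((s ^+ 2)^-1 * \sum_(k < n) \int[P]_w (Y k w ^+ 2)).
    rewrite mulr_sumr; apply: eq_bigr => k _.
    have [_ <-] := RintegralZ_L1 (s ^+ 2)^-1 (iY2 k).
    by apply: eq_Rintegral => w _; rewrite /Z exprMn exprVn.
  by rewrite -s2 mulVf// expf_neq0.
have Y3 : \sum_(k < n) \int[P]_w (Y k w ^+ 3) = 0.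
  apply: EFin_inj; rewrite -sumEFin -[RHS]third.
  by apply: eq_bigr => k _; rewrite (expectation_EFin (iY3 k)).
have EZ3 : \sum_(k < n) \int[P]_w (Z k w ^+ 3) = 0.
  transitivity ((s ^+ 3)^-1 * \sum_(k < n) \int[P]_w (Y k w ^+ 3)).
    rewrite mulr_sumr; apply: eq_bigr => k _.
    have [_ <-] := RintegralZ_L1 (s ^+ 3)^-1 (iY3 k).
    by apply: eq_Rintegral => w _; rewrite /Z exprMn exprVn.
  by rewrite Y3 mulr0.
have indepZ k : independent_pair P (Z k) (fun w => \sum_(j < n | j != k) Z j w).
  pose g (j : 'I_n) (x : R) := s^-1 * (x - mean P (X j)).
  have mg j : measurable_fun setT (g j).
    by apply: measurable_funM => //; exact: measurable_funB.
  have := independent_leave_one_out k mg indep.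
  exact: (independent_pair_comp (mg k) (@measurable_id _ R setT)).
have GE : (fun w => centered_sum X w / s) = (fun w => \sum_(k < n) Z k w).
  by apply/funext => w; rewrite /centered_sum mulrC mulr_sumr.
have rhsE : (\sum_(k < n) 'E_P[fun w => (`|centered P (X k) w| `^ p)%R])%E =
    (\sum_(k < n) \int[P]_w (`|Y k w| `^ p))%R%:E.
  by rewrite -sumEFin; apply: eq_bigr => k _; rewrite (expectation_EFin (iY k)).
rewrite rhsE -EFinM.
apply: ge_ereal_sup => _ [h [Ch h1 h2] <-].
have [dh dh1] := C2_is_derive Ch.
have [f [f1 [f2 [[df df1] fE [fB f1B] [cf2 f2B] f2L]]]] :=
  stein_equation dh dh1 (sup_norm_le1 h1) (sup_norm_le1 h2).
have mh : measurable_fun setT h := continuous_measurable_fun (is_derive_continuous dh).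
have hg x : `|h x| <= (`|h 0| + 1) * (1 + `|x|).
  apply: (le_trans (linear_growth dh (sup_norm_le1 h1) x)).
  have := mulr_ge0 (normr_ge0 (h 0)) (normr_ge0 x); lra.
have ENh : ('E_Q[h \o N] = (\int[normal_prob 0 1]_y h y)%:E)%E :=
  expectation_standard_normal normalN mh hg.
have iZ1 k : P.-integrable setT (EFin \o Z k) := L1_exprn (mZ k) le1 (iZ k).
have [iW _] := Rintegral_sum_L1 (index_enum 'I_n) iZ1.
have iWabs := integrable_norm iW.
pose W w := \sum_(k < n) Z k w.
have mW : measurable_fun setT W by exact: measurable_sum.
have ihW : P.-integrable setT (EFin \o (fun w => h (W w))).
  have [i1 _] := RintegralD_L1 (finite_measure_integrable_cst P 1 measurableT) iWabs.
  have [i2 _] := RintegralZ_L1 (`|h 0| + 1) i1.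
  by apply: L1_dominated i2 (fun w => hg (W w)); exact: (measurableT_comp mh mW).
have c_int : P.-integrable setT (EFin \o (fun=> \int[normal_prob 0 1]_y h y)).
  exact: finite_measure_integrable_cst.
rewrite GE ENh (expectation_EFin ihW) -EFinB lee_fin.
have -> : \int[P]_w h (W w) - \int[normal_prob 0 1]_y h y =
    \int[P]_w (f1 (W w) - W w * f (W w)).
  under [RHS]eq_Rintegral do rewrite fE.
  rewrite RintegralB// Rintegral_cst// (_ : fine _ = 1) ?mulr1//.
  exact: (congr1 fine (probability_setT P)).
have fH := hoelder_of_lipschitz (introT andP (conj d0 d1)) (ler0n R 4)
  (divr_ge0 (ler0n R 5) (ler0n R 2)) f2B f2L.
have B1 : 1 <= 5 / 2 :> R by lra.
have B2 : 1 / 2 <= 5 / 2 :> R by lra.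
(* 4 is the Lipschitz constant of f2 and 5 / 2 its uniform bound. *)
have M5 : Num.max 4 (2 * (5 / 2)) = 5 :> R by rewrite mulrC divfK// max_r// ler_nat.
rewrite M5 in fH.
have := stein_discrepancy_le (fun w => erefl (W w)) mZ indepZ (ler0n R 5) d0 iZ
  EZ0 EZ2 EZ3 df df1 cf2 (fun x => le_trans (fB x) B1) (fun x => le_trans (f1B x) B2)
  f2B fH.
move=> /le_trans; apply.
under eq_bigr do rewrite eZ.
rewrite -mulr_sumr mulrA ler_wpM2r//.
  by apply: sumr_ge0 => k _; apply: Rintegral_ge0 => w _; exact: powR_ge0.
by rewrite ler_wpM2r ?invr_ge0 ?powR_ge0// C_ge// ltW.
Qed.
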